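(* Let $A$ and $B$ be $C^{*}$-algebras. Then the Banach algebra $A\widehat{\otimes} B$ is weakly Wiener.
   Context: For $C^{*}$-algebras $A,B$ (with their canonical operator space structures) and $u$ in the algebraic tensor product $A\otimes B$, the operator space projective tensor norm is $\|u\|_{\wedge}=\inf\{\|\alpha\|\|x\|\|y\|\|\beta\| : u=\alpha(x\otimes y)\beta\}$, where $\alpha\in M_{1,pq}(\mathbb{C})$, $\beta\in M_{pq,1}(\mathbb{C})$, $x\in M_{p}(A)$, $y\in M_{q}(B)$, $p,q\in\mathbb{N}$, and $x\otimes y=(x_{ij}\otimes y_{kl})_{(i,k),(j,l)}\in M_{pq}(A\otimes B)$. The completion of $A\otimes B$ in this norm is denoted $A\widehat{\otimes}B$; it is a Banach $^{*}$-algebra under the product and involution determined by $(a\otimes b)(c\otimes d)=ac\otimes bd$ and $(a\otimes b)^{*}=a^{*}\otimes b^{*}$. ''Ideal'' means two-sided ideal. A primitive ideal of an algebra $D$ is an ideal of the form $L:D=\{a\in D : aD\subseteq L\}$ for some maximal modular left ideal $L$ of $D$. A Banach algebra $D$ is weakly Wiener if every proper closed ideal of $D$ is contained in some primitive ideal of $D$. *)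

(* Defs.v *)
(* MathComp-Analysis, with the complex numbers R[i] of mathcomp-real-closed over
   an arbitrary realType R. *)
From HB Require Import structures.
From mathcomp Require Import all_boot all_order all_algebra.
From mathcomp Require Import generic_quotient complex mxtens.
From mathcomp Require Import all_classical all_reals all_analysis.

Set Implicit Arguments.
Unset Strict Implicit.
Unset Printing Implicit Defensive.
Import Order.TTheory GRing.Theory Num.Theory.
Import numFieldNormedType.Exports.

Local Open Scope classical_set_scope.
Local Open Scope quotient_scope.
Local Open Scope ring_scope.
Local Open Scope complex_scope.

(* Banach algebras and C*-algebras are not assumed to be unital, so their product
   is not a MathComp ring product. *)
HB.mixin Record isBanachAlgebra (R : realType) D
    of CompleteNormedModule R[i] D := {
  bmul : D -> D -> D ;
  bmulA : associative bmul ;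
  bmul_bilinear : bilinear_for *:%R *:%R bmul ;
  norm_bmul : forall x y : D, `|bmul x y| <= `|x| * `|y| }.

#[short(type="banachAlgType")]
HB.structure Definition BanachAlgebra (R : realType) :=
  {D of isBanachAlgebra R D & CompleteNormedModule R[i] D}.

Infix "**" := bmul (at level 40, left associativity) : ring_scope.

HB.mixin Record isCStarAlgebra (R : realType) A of BanachAlgebra R A := {
  star : A -> A ;
  starK : involutive star ;
  starD : forall x y : A, star (x + y) = star x + star y ;
  starZ : forall (c : R[i]) (x : A), star (c *: x) = c^* *: star x ;
  starM : forall x y : A, star (x ** y) = star y ** star x ;
  cstar_identity : forall x : A, `|star x ** x| = `|x| ^+ 2 }.

#[short(type="cstarAlgType")]
HB.structure Definition CStarAlgebra (R : realType) :=
  {A of isCStarAlgebra R A & BanachAlgebra R A}.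

(* Norms of modules over R[i] take values in R[i]; rnorm is the same norm seen as
   a real number. *)
Definition rnorm (R : realType) (V : normedModType R[i]) (x : V) : R :=
  complex.Re `|x|.

Section MatrixNorm.
Context {R : realType} {A : cstarAlgType R} {p : nat}.
Implicit Types x y : 'M[A]_p.

Definition mxmul x y : 'M[A]_p := \matrix_(i, j) \sum_k x i k ** y k j.
Definition mxstar x : 'M[A]_p := \matrix_(i, j) star (x j i).
Definition mxscale (c : R[i]) x : 'M[A]_p := \matrix_(i, j) (c *: x i j).

(* Completeness of M_p(A) need not be required: for this *-algebra it follows
   from the other properties. *)
Record is_cstar_mxnorm (N : 'M[A]_p -> R) : Prop := IsCStarMxNorm {
  mxnorm_eq0 : forall x, N x = 0 -> x = 0 ;
  mxnormD : forall x y, N (x + y) <= N x + N y ;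
  mxnormZ : forall c x, N (mxscale c x) = complex.Re `|c| * N x ;
  mxnormM : forall x y, N (mxmul x y) <= N x * N y ;
  mxnorm_cstar : forall x, N (mxmul (mxstar x) x) = N x ^+ 2 }.

(* The canonical operator space structure of A: the norm of M_p(A) is the unique
   norm which makes it a C*-algebra. The default value is never used. *)
Definition mxnorm : 'M[A]_p -> R := xget (fun=> 0) [set N | is_cstar_mxnorm N].

End MatrixNorm.

Section AlgebraicTensorProduct.
Context {K : fieldType} (U V : lmodType K).

(* The list [:: (a1, b1); ...; (an, bn)] stands for a1 (x) b1 + ... + an (x) bn;
   two lists are identified when no bilinear map tells them apart. *)
Definition tens_eval (W : lmodType K) (f : U -> V -> W) (s : seq (U * V)) : W :=
  \sum_(ab <- s) f ab.1 ab.2.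

Definition tens_rel (s t : seq (U * V)) : bool :=
  `[< forall (W : lmodType K) (f : {bilinear U -> V -> W}),
        tens_eval f s = tens_eval f t >].

Lemma tens_rel_refl : reflexive tens_rel.
Proof. by move=> s; apply/asboolP. Qed.

Lemma tens_rel_sym : symmetric tens_rel.
Proof. by move=> s t; apply/asboolP/asboolP => h W f; rewrite h. Qed.

Lemma tens_rel_trans : transitive tens_rel.
Proof.
by move=> t s u /asboolP h1 /asboolP h2; apply/asboolP => W f; rewrite h1 h2.
Qed.

Canonical tens_equiv :=
  EquivRel tens_rel tens_rel_refl tens_rel_sym tens_rel_trans.

Definition atensor := {eq_quot tens_equiv}.
HB.instance Definition _ := Choice.on atensor.
HB.instance Definition _ := EqQuotient.on atensor.

Lemma tens_relP s t :
  reflect (forall (W : lmodType K) (f : {bilinear U -> V -> W}),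
             tens_eval f s = tens_eval f t)
          (s == t %[mod atensor]).
Proof. by rewrite eqmodE; exact: asboolP. Qed.

Lemma tens_eval_repr (W : lmodType K) (f : {bilinear U -> V -> W}) s :
  tens_eval f (repr (\pi_atensor s)) = tens_eval f s.
Proof. by move: W f; apply/tens_relP; rewrite reprK. Qed.

Let scale_seq (c : K) (s : seq (U * V)) := [seq (c *: ab.1, ab.2) | ab <- s].

Let tens_eval_cat (W : lmodType K) (f : {bilinear U -> V -> W}) s t :
  tens_eval f (s ++ t) = tens_eval f s + tens_eval f t.
Proof. by rewrite /tens_eval big_cat. Qed.

Let tens_eval_scale (W : lmodType K) (f : {bilinear U -> V -> W}) c s :
  tens_eval f (scale_seq c s) = c *: tens_eval f s.
Proof.
rewrite /tens_eval big_map scaler_sumr; apply: eq_bigr => ab _ /=.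
by rewrite linearZl_LR.
Qed.

Definition tens0 : atensor := \pi_atensor [::].
Definition tensD (u v : atensor) : atensor := \pi_atensor (repr u ++ repr v).
Definition tensZ (c : K) (u : atensor) : atensor :=
  \pi_atensor (scale_seq c (repr u)).
Definition tensN (u : atensor) : atensor := tensZ (-1) u.

(* Equalities in atensor are checked by evaluating bilinear maps. *)
Let tensP (u v : atensor) :
  (forall (W : lmodType K) (f : {bilinear U -> V -> W}),
     tens_eval f (repr u) = tens_eval f (repr v)) -> u = v.
Proof. by move=> h; rewrite -[u]reprK -[v]reprK; apply/eqP/tens_relP. Qed.

Let evalE := (tens_eval_repr, tens_eval_cat, tens_eval_scale).

Let tens_eval0 (W : lmodType K) (f : U -> V -> W) : tens_eval f [::] = 0.
Proof. exact: big_nil. Qed.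

Let tensDA : associative tensD.
Proof. by move=> u v w; apply: tensP => W f; rewrite !evalE addrA. Qed.
Let tensDC : commutative tensD.
Proof. by move=> u v; apply: tensP => W f; rewrite !evalE addrC. Qed.
Let tens0D : left_id tens0 tensD.
Proof. by move=> u; apply: tensP => W f; rewrite !evalE tens_eval0 add0r. Qed.
Let tensND : left_inverse tens0 tensN tensD.
Proof.
by move=> u; apply: tensP => W f; rewrite !evalE tens_eval0 scaleN1r addNr.
Qed.

HB.instance Definition _ :=
  GRing.isZmodule.Build atensor tensDA tensDC tens0D tensND.

Let tensZA c d u : tensZ c (tensZ d u) = tensZ (c * d) u.
Proof. by apply: tensP => W f; rewrite !evalE scalerA. Qed.
Let tens1Z : left_id 1 tensZ.
Proof. by move=> u; apply: tensP => W f; rewrite !evalE scale1r. Qed.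
Let tensZDr : right_distributive tensZ +%R.
Proof. by move=> c u v; apply: tensP => W f; rewrite !evalE scalerDr. Qed.
Let tensZDl u : {morph tensZ^~ u : c d / c + d}.
Proof. by move=> c d; apply: tensP => W f; rewrite !evalE scalerDl. Qed.

HB.instance Definition _ :=
  GRing.Zmodule_isLmodule.Build K atensor tensZA tens1Z tensZDr tensZDl.

Definition tens (a : U) (b : V) : atensor := \pi_atensor [:: (a, b)].

Let eval_tens (W : lmodType K) (f : {bilinear U -> V -> W}) a b :
  tens_eval f (repr (tens a b)) = f a b.
Proof. by rewrite tens_eval_repr /tens_eval big_seq1. Qed.

Lemma tens_bilinear : bilinear_for *:%R *:%R tens.
Proof.
by split=> [b c a a'|a c b b']; apply: tensP => W f;
  rewrite !(evalE, eval_tens) ?linearPl ?linearPr.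
Qed.

HB.instance Definition _ :=
  bilinear_isBilinear.Build K U V atensor _ _ tens tens_bilinear.

(* The universal property of the algebraic tensor product. *)
Definition tens_lift (W : lmodType K) (f : {bilinear U -> V -> W})
    (u : atensor) : W :=
  tens_eval f (repr u).

Lemma tens_lift_linear (W : lmodType K) (f : {bilinear U -> V -> W}) :
  linear (tens_lift f).
Proof. by move=> c u v; rewrite /tens_lift !evalE. Qed.

Lemma tens_lift_tens (W : lmodType K) (f : {bilinear U -> V -> W}) a b :
  tens_lift f (tens a b) = f a b.
Proof. exact: eval_tens. Qed.

Lemma atensorE (u : atensor) : exists s : seq (U * V),
  u = \sum_(ab <- s) tens ab.1 ab.2.
Proof.
exists (repr u); apply: tensP => W f; rewrite -[RHS]/(tens_lift f _).
pose g : {linear atensor -> W} := HB.pack (tens_lift f)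
  (GRing.isLinear.Build _ _ _ _ (tens_lift f) (tens_lift_linear f)).
rewrite -[RHS]/(g _) linear_sum; apply: eq_bigr => ab _.
by rewrite [RHS]tens_lift_tens.
Qed.

End AlgebraicTensorProduct.

Section ProjectiveTensorProduct.
Context {R : realType} {A B : cstarAlgType R}.
Local Notation "A ⊗ B" := (atensor A B) (at level 40).

(* mxtens_unindex : 'I_(p * q) -> 'I_p * 'I_q is the bijection that identifies
   the row indices (i, k) and the column indices (j, l) with 'I_(p * q). *)
Definition kron (p q : nat) (x : 'M[A]_p) (y : 'M[B]_q) :
    'M[A ⊗ B]_(p * q) :=
  \matrix_(r, s) tens (x (mxtens_unindex r).1 (mxtens_unindex s).1)
                      (y (mxtens_unindex r).2 (mxtens_unindex s).2).

Definition mxsandwich (n : nat) (alpha : 'rV[R[i]]_n) (z : 'M[A ⊗ B]_n)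
    (beta : 'cV[R[i]]_n) : A ⊗ B :=
  \sum_r \sum_s (alpha ord0 r * beta s ord0) *: z r s.

(* For a row or a column this Hilbert-Schmidt norm is the operator norm. *)
Definition hsnorm (m n : nat) (c : 'M[R[i]]_(m, n)) : R :=
  Num.sqrt (\sum_i \sum_j complex.Re `|c i j| ^+ 2).

Definition opproj_norm (u : A ⊗ B) : R :=
  inf [set r | exists p q (alpha : 'rV[R[i]]_(p * q)) (x : 'M[A]_p)
                 (y : 'M[B]_q) (beta : 'cV[R[i]]_(p * q)),
      u = mxsandwich alpha (kron x y) beta /\
      r = hsnorm alpha * mxnorm x * mxnorm y * hsnorm beta].

(* D, with j, is the completion of A ⊗ B in the norm opproj_norm, and its product
   extends (a ⊗ b)(c ⊗ d) = ac ⊗ bd. This determines the Banach algebra D up to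
   isometric isomorphism. *)
Record is_opproj_tensor (D : banachAlgType R) (j : {linear A ⊗ B -> D}) : Prop :=
  IsOpprojTensor {
    opproj_isometry : forall u, rnorm (j u) = opproj_norm u ;
    opproj_dense : dense (range j) ;
    opproj_mul : forall a b c d,
      j (tens a b) ** j (tens c d) = j (tens (a ** c) (b ** d)) }.

End ProjectiveTensorProduct.

Section Ideals.
Context {R : realType} {D : banachAlgType R}.
Implicit Types I J L P : set D.

Definition subspace I : Prop :=
  I 0 /\ forall (c : R[i]) x y, I x -> I y -> I (c *: x + y).

Definition left_ideal L : Prop :=
  subspace L /\ forall a x, L x -> L (a ** x).

Definition ideal I : Prop :=
  left_ideal I /\ forall a x, I x -> I (x ** a).

Definition modular L : Prop := exists e : D, forall a, L (a - a ** e).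

Definition maximal_modular_left_ideal L : Prop :=
  [/\ left_ideal L, modular L, L <> setT &
    forall J, left_ideal J -> modular J -> J <> setT -> L `<=` J -> J = L].

(* L : D *)
Definition ideal_quotient L : set D := [set a | forall d, L (a ** d)].

Definition primitive_ideal P : Prop :=
  exists2 L, maximal_modular_left_ideal L & P = ideal_quotient L.

End Ideals.

Definition weakly_wiener (R : realType) (D : banachAlgType R) : Prop :=
  forall I : set D, ideal I -> closed I -> I <> setT ->
    exists2 P, primitive_ideal P & I `<=` P.

(* Main.v *)
Require Import Defs.
From mathcomp Require Import all_boot all_order all_algebra.
From mathcomp Require Import all_classical all_reals all_analysis.
From mathcomp Require Import complex ring lra.

(* Let I be a closed ideal of D contained in no primitive ideal. Every e in D is
   then left quasi-invertible modulo I, so e x = x implies x in I. In a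
   C*-algebra every selfadjoint element is a limit of elements x that have a unit
   e x = x, so I contains the elementary tensors of selfadjoint elements, by
   continuity of the tensor product map, and hence I = D.

   The functional calculus behind the units only involves square roots and
   resolvents, obtained by fixed point iterations. Norms are bounded by
   exhibiting elements as real or imaginary parts of unitaries; the same argument
   bounds every C*-norm by the norm of A, which identifies the norm of M_1(A). *)

Set Implicit Arguments.
Unset Strict Implicit.
Unset Printing Implicit Defensive.
Import Order.TTheory GRing.Theory Num.Theory.
Import numFieldNormedType.Exports.

Local Open Scope classical_set_scope.
Local Open Scope ring_scope.
Local Open Scope complex_scope.

(** * Real values of complex-valued norms *)

Section RealNorm.
Context {R : realType} {V : normedModType R[i]}.
Implicit Types (x y : V) (c : R[i]).

Lemma ge0_ReK c : 0 <= c -> (complex.Re c)%:C = c.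
Proof. by case: c => a b; rewrite lecE /= => /andP[/eqP-> _]. Qed.

Lemma rnormE x : `|x| = (rnorm x)%:C.
Proof. by rewrite /rnorm ge0_ReK. Qed.

Lemma rnorm_le x (r : R) : (`|x| <= r%:C) = (rnorm x <= r).
Proof. by rewrite rnormE lecR. Qed.

Lemma rnorm_ge0 x : 0 <= rnorm x.
Proof. by rewrite -ler0c -rnormE. Qed.

Lemma rnorm0_eq0 x : rnorm x = 0 -> x = 0.
Proof. by move=> x0; apply/eqP; rewrite -normr_eq0 rnormE x0. Qed.

Lemma rnormD x y : rnorm (x + y) <= rnorm x + rnorm y.
Proof. by rewrite -lecR rmorphD /= -!rnormE ler_normD. Qed.

Lemma rnormZ c x : rnorm (c *: x) = complex.Re `|c| * rnorm x.
Proof.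
by apply: complexI; rewrite rmorphM /= ge0_ReK // -!rnormE normrZ.
Qed.

Lemma rnormN x : rnorm (- x) = rnorm x.
Proof. by rewrite /rnorm normrN. Qed.

Lemma rnorm0 : rnorm (0 : V) = 0.
Proof. by rewrite /rnorm normr0. Qed.

Lemma rnormZr (r : R) x : 0 <= r -> rnorm (r%:C *: x) = r * rnorm x.
Proof. by move=> r0; rewrite rnormZ ger0_norm// lecR. Qed.

End RealNorm.

(** * Arithmetic in a nonunital Banach algebra *)

Section BanachAlgebraTheory.
Context {R : realType} {D : banachAlgType R}.
Implicit Types (x y z : D) (c : R[i]).

Lemma bmulDl x y z : (x + y) ** z = x ** z + y ** z.
Proof. by have := bmul_bilinear.1 z 1 x y; rewrite /= !scale1r. Qed.

Lemma bmulDr x y z : x ** (y + z) = x ** y + x ** z.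
Proof. by have := bmul_bilinear.2 x 1 y z; rewrite /= !scale1r. Qed.

Lemma bmul0l x : 0 ** x = 0.
Proof. by apply: (addrI (0 ** x)); rewrite -bmulDl !addr0. Qed.

Lemma bmul0r x : x ** 0 = 0.
Proof. by apply: (addrI (x ** 0)); rewrite -bmulDr !addr0. Qed.

Lemma bmulZl c x y : (c *: x) ** y = c *: (x ** y).
Proof. by have := bmul_bilinear.1 y c x 0; rewrite /= bmul0l !addr0. Qed.

Lemma bmulZr c x y : x ** (c *: y) = c *: (x ** y).
Proof. by have := bmul_bilinear.2 x c y 0; rewrite /= bmul0r !addr0. Qed.

Lemma bmulNl x y : (- x) ** y = - (x ** y).
Proof. by rewrite -scaleN1r bmulZl scaleN1r. Qed.

Lemma bmulNr x y : x ** (- y) = - (x ** y).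
Proof. by rewrite -scaleN1r bmulZr scaleN1r. Qed.

Lemma bmulBl x y z : (x - y) ** z = x ** z - y ** z.
Proof. by rewrite bmulDl bmulNl. Qed.

Lemma bmulBr x y z : x ** (y - z) = x ** y - x ** z.
Proof. by rewrite bmulDr bmulNr. Qed.

Lemma rnormM x y : rnorm (x ** y) <= rnorm x * rnorm y.
Proof. by rewrite -lecR rmorphM /= -!rnormE norm_bmul. Qed.

End BanachAlgebraTheory.

(** * Maximal modular left ideals and elements with a local unit *)

Section Ideals.
Context {R : realType} {D : banachAlgType R}.
Implicit Types (I J L : set D).

(** Every left ideal containing [J] has [e] as a right modular unit, so it is proper exactly when it
    misses [e]. Missing [e] survives unions of chains, and Zorn's lemma applies. *)
Lemma maximal_left_ideal_ext J (e : D) :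
  left_ideal J -> (forall a, J (a - a ** e)) -> ~ J e ->
  exists2 L, maximal_modular_left_ideal L & J `<=` L.
Proof.
move=> Jl Je nJe.
have full K : left_ideal K -> J `<=` K -> K e -> K = setT.
  move=> [[_ K2] K3] JK Ke; rewrite -subTset => a _.
  by rewrite -[a](subrK (a ** e)) -[a - _]scale1r; apply: K2; auto.
pose P (X : set D) := X = set0 \/ [/\ left_ideal X, J `<=` X & ~ X e].
have [F FP Ftot|L [PL Lmax]] := @Zorn_bigcup D P.
  have [[X [FX X0]]|F0] := pselect (exists X, F X /\ X !=set0); last first.
    left; rewrite -subset0 => x [X FX Xx]; case: F0.
    by exists X; split => //; exists x.
  right; have PX Y : F Y -> Y !=set0 -> [/\ left_ideal Y, J `<=` Y & ~ Y e].
    by move=> /FP [->|//] [].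
  split.
  - have [[[X00 _] _] _ _] := PX _ FX X0.
    split; [split; first by exists X|].
    + move=> c x y [Y FY Yx] [Z FZ Zy].
      have [YZ|ZY] := Ftot _ _ FY FZ.
      * have [|[[_ Z2] _] _ _] := PX _ FZ; first by exists y.
        by exists Z => //; apply: Z2 => //; exact: YZ.
      * have [|[[_ Y2] _] _ _] := PX _ FY; first by exists x.
        by exists Y => //; apply: Y2 => //; exact: ZY.
    + move=> a x [Y FY Yx].
      have [|[_ Y3] _ _] := PX _ FY; first by exists x.
      by exists Y => //; exact: Y3.
  - by move=> x Jx; exists X => //; have [_ + _] := PX _ FX X0; apply.
  - move=> [Y FY Ye]; have [|_ _] := PX _ FY; first by exists e.
    exact.
have [L0|[Ll JL nLe]] := PL.
  exfalso; apply: (Lmax J); last by right; split.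
  rewrite L0; split=> [x []|/(_ 0)]; apply.
  by have [[]] := Jl.
exists L => //; split => //.
- by exists e => a; exact: JL.
- by move=> LT; apply: nLe; rewrite LT.
move=> K Kl _ KT LK; apply/seteqP; split => //.
apply: contrapT => nKL; apply: (Lmax K) => //; right; split => //.
  exact: subset_trans LK.
by move=> Ke; apply: KT; apply: full => //; exact: subset_trans LK.
Qed.

(* If the left ideal [I + D(1 - e)] contains [e], then [e = i + d(1 - e)] with
   [i] in [I], and multiplying by [x] gives [x = i x]. *)
Lemma local_unit_in_ideal I (e x : D) :
  ideal I -> ~ (exists2 P, primitive_ideal P & I `<=` P) ->
  e ** x = x -> I x.
Proof.
move=> [[[I0 I2] I3] I4] noP ex.
pose J := [set u | exists i d, I i /\ u = i + (d - d ** e)].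
have Jl : left_ideal J.
  split; [split|].
  - by exists 0, 0; rewrite bmul0l subrr addr0.
  - move=> c _ _ [i [d [Ii ->]]] [i' [d' [Ii' ->]]].
    exists (c *: i + i'), (c *: d + d'); split; first exact: I2.
    rewrite bmulDl bmulZl scalerDr scalerBr addrACA; congr (_ + _).
    by rewrite opprD [RHS]addrACA.
  - move=> a _ [i [d [Ii ->]]].
    exists (a ** i), (a ** d); split; first exact: I3.
    by rewrite bmulDr bmulBr bmulA.
have [[i [d [Ii e_eq]]]|nJe] := pselect (J e).
  by rewrite -ex e_eq bmulDl bmulBl -bmulA ex subrr addr0; exact: I4.
(* Otherwise [J] lies in a maximal modular [L]. As I D is contained in I, hence in [J] and [L], the
   primitive ideal L : D contains [I]. *)
have [|L Lmax JL] := maximal_left_ideal_ext Jl _ nJe.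
  by move=> a; exists 0, a; rewrite add0r.
case: noP; exists (ideal_quotient L); first by exists L.
move=> a Ia d; apply: JL; exists (a ** d), 0; split; first exact: I4.
by rewrite bmul0l subrr addr0.
Qed.

End Ideals.

(** * Convergence, closedness and continuity in terms of real norms *)

Section Limits.
Context {R : realType}.

Lemma cvg_rnormP (V : normedModType R[i]) (s : nat -> V) (l : V) :
  s @ \oo --> l <->
  forall r : R, 0 < r ->
    exists m, forall n, (m <= n)%N -> rnorm (l - s n) <= r.
Proof.
split=> [/cvgrPdist_le sl r r0|sl].
  have [|m _ sm] := sl r%:C; first by rewrite ltcR.
  by exists m => n /sm; rewrite rnorm_le.
apply/cvgrPdist_le => e e0.
have [m sm] : exists m, forall n, (m <= n)%N -> rnorm (l - s n) <= complex.Re e.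
  by apply: sl; rewrite -ltcR ge0_ReK// ltW.
by exists m => // n /sm; rewrite -rnorm_le ge0_ReK// ltW.
Qed.

(** The increments of [sigma] are nonnegative, so [sigma] increases to its supremum; once it is
    within epsilon of it, [s] moves by less than epsilon. *)
Lemma cvg_majorant (V : completeNormedModType R[i]) (s : nat -> V)
    (sigma : nat -> R) (M : R) :
  (forall n, rnorm (s n.+1 - s n) <= sigma n.+1 - sigma n) ->
  (forall n, sigma n <= M) ->
  cvgn s.
Proof.
move=> sS sM; apply/cauchy_cvgP/cauchy_exP => e e0.
have eE : (complex.Re e)%:C = e by rewrite ge0_ReK// ltW.
have r0 : 0 < complex.Re e by rewrite -ltcR eE.
have smn m n : rnorm (s (m + n)%N - s m) <= sigma (m + n)%N - sigma m.
  elim: n => [|n IH]; first by rewrite addn0 !subrr rnorm0.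
  rewrite addnS -(subrKA (s (m + n)%N)) (le_trans (rnormD _ _))//.
  by have := sS (m + n)%N; lra.
have supS : has_sup (range sigma).
  by split; [exists (sigma 0%N), 0%N|exists M => _ [n _ <-]].
have [_ [m _ <-] mlt] := sup_adherent r0 supS.
exists (s m); exists m => // n /subnKC <-.
rewrite -ball_normE /ball_ /= distrC rnormE -eE ltcR.
apply: le_lt_trans (smn _ _) _; rewrite ltrBlDr.
have : sigma (m + (n - m))%N <= sup (range sigma).
  by apply: ub_le_sup => //; case: supS.
by move: mlt; lra.
Qed.

Lemma cvg_rnorm_le (V : normedModType R[i]) (s : nat -> V) (l : V) (M : R) :
  s @ \oo --> l -> (forall n, rnorm (s n) <= M) -> rnorm l <= M.
Proof.
move=> /cvg_rnormP sl sM; apply/ler_addgt0Pr => e e0.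
have [m /(_ m (leqnn m)) sm] := sl e e0.
rewrite -(subrK (s m) l) (le_trans (rnormD _ _))//.
by have := sM m; lra.
Qed.

Lemma closed_rnorm (V : normedModType R[i]) (I : set V) x :
  closed I -> (forall r : R, 0 < r -> exists y, I y /\ rnorm (x - y) <= r) ->
  I x.
Proof.
move=> Iclosed xI; apply: Iclosed => U /nbhs_ballP[e e0 eU].
have eE : (complex.Re e)%:C = e by rewrite ge0_ReK// ltW.
have e20 : 0 < complex.Re e / 2 by rewrite divr_gt0// -ltcR eE.
have [y [Iy xy]] := xI _ e20.
exists y; split => //; apply: eU.
rewrite -ball_normE /ball_ /= rnormE -eE ltcR.
by apply: le_lt_trans xy _; lra.
Qed.

(** Stated for a general [f] to serve both the product of a Banach algebra and the tensor product
    map. *)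
Lemma bounded_biadditive_continuous (U V W : normedModType R[i])
    (f : U -> V -> W) (a : U) (b : V) (r : R) :
  (forall x x' y, f (x - x') y = f x y - f x' y) ->
  (forall x y y', f x (y - y') = f x y - f x y') ->
  (forall x y, rnorm (f x y) <= rnorm x * rnorm y) -> 0 < r ->
  exists2 d : R, 0 < d & forall x y, rnorm (a - x) <= d ->
    rnorm (b - y) <= d -> rnorm (f a b - f x y) <= r.
Proof.
move=> fBl fBr fM r0; have a0 := rnorm_ge0 a; have b0 := rnorm_ge0 b.
have C0 : 0 < rnorm a + rnorm b + 1 by rewrite ltr_wpDl// addr_ge0.
(* The bound by 1 turns the quadratic error d^2 into at most d. *)
pose d := Num.min 1 (r / (rnorm a + rnorm b + 1)).
have d1 : d <= 1 by rewrite ge_min lexx.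
have dr : d * (rnorm a + rnorm b + 1) <= r.
  by rewrite -ler_pdivlMr// ge_min lexx orbT.
exists d => [|x y ax bY]; first by rewrite lt_min ltr01 divr_gt0.
have -> : f a b - f x y = f a (b - y) + (f (a - x) b - f (a - x) (b - y)).
  by rewrite -[in RHS]fBr subKr fBr fBl addrA subrK.
have u0 := rnorm_ge0 (a - x); have w0 := rnorm_ge0 (b - y).
rewrite (le_trans (rnormD _ _))// (le_trans (lerD (fM _ _) (rnormD _ _)))//.
rewrite rnormN (le_trans (lerD (lexx _) (lerD (fM _ _) (fM _ _))))//.
apply: le_trans dr.
have h1 : rnorm a * rnorm (b - y) <= rnorm a * d by apply: ler_wpM2l.
have h2 : rnorm (a - x) * rnorm b <= d * rnorm b by apply: ler_wpM2r.
have h3 : rnorm (a - x) * rnorm (b - y) <= d * 1.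
  by apply: ler_pM => //; exact: le_trans d1.
lra.
Qed.

Lemma cvg_bmul (D : banachAlgType R) (s t : nat -> D) (a b : D) :
  s @ \oo --> a -> t @ \oo --> b -> (fun n => s n ** t n) @ \oo --> a ** b.
Proof.
move=> /cvg_rnormP sa /cvg_rnormP tb; apply/cvg_rnormP => r r0.
have [d d0 dP] := bounded_biadditive_continuous a b (@bmulBl _ D)
  (@bmulBr _ D) (@rnormM _ D) r0.
have [m sm] := sa d d0; have [m' tm] := tb d d0.
by exists (maxn m m') => n; rewrite geq_max => /andP[/sm sn /tm tn]; exact: dP.
Qed.

End Limits.

(** * The involution and C*-seminorms *)

Section CStarAlgebraTheory.
Context {R : realType} {A : cstarAlgType R}.
Implicit Types (x y z p k v w : A) (c : R[i]).

Lemma rnorm_cstar x : rnorm (star x ** x) = rnorm x ^+ 2.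
Proof.
by apply: complexI; rewrite rmorphXn /= -!rnormE cstar_identity.
Qed.

Lemma rnorm_star x : rnorm (star x) = rnorm x.
Proof.
suff le y : rnorm y <= rnorm (star y).
  by apply/eqP; rewrite eq_le le -{2}[x]starK le.
have [->|y0] := eqVneq (rnorm y) 0; first exact: rnorm_ge0.
have {}y0 : 0 < rnorm y by rewrite lt_def y0 rnorm_ge0.
by rewrite -(ler_pM2r y0) -expr2 -rnorm_cstar rnormM.
Qed.

Lemma star0 : star (0 : A) = 0.
Proof. by apply: (addrI (star 0)); rewrite -starD !addr0. Qed.

Lemma starN x : star (- x) = - star x.
Proof. by apply: (addrI (star x)); rewrite -starD !subrr star0. Qed.

Lemma starB x y : star (x - y) = star x - star y.
Proof. by rewrite starD starN. Qed.

Lemma starZr (r : R) x : star (r%:C *: x) = r%:C *: star x.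
Proof.
by rewrite starZ conj_Creal//; apply/Creal_ImP; rewrite -complexIm.
Qed.

Lemma cvg_star (s : nat -> A) (l : A) :
  s @ \oo --> l -> (fun n => star (s n)) @ \oo --> star l.
Proof.
move=> /cvg_rnormP sl; apply/cvg_rnormP => r /sl [m sm].
by exists m => n /sm; rewrite -starB rnorm_star.
Qed.

(** Common ground of the norm of [A] and of any C*-norm on 1 x 1 matrices over [A]. *)
Definition cstar_seminorm (N : A -> R) : Prop :=
  [/\ forall x y, N (x + y) <= N x + N y,
      forall c x, N (c *: x) = complex.Re `|c| * N x &
      forall x, N (star x ** x) = N x ^+ 2].

Lemma rnorm_cstar_seminorm : cstar_seminorm (@rnorm R A).
Proof. by split; [exact: rnormD|exact: rnormZ|exact: rnorm_cstar]. Qed.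

(** * Contractions obtained from unitaries *)

Section Seminorm.
Variables (N : A -> R) (HN : cstar_seminorm N).

Lemma seminormN x : N (- x) = N x.
Proof.
have [_ NZ _] := HN.
by rewrite -scaleN1r NZ normrN normr1 mul1r.
Qed.

Lemma seminorm_ge0 x : 0 <= N x.
Proof.
have [ND NZ _] := HN.
have : N 0 <= N x + N x by rewrite -{2}(seminormN x) -(subrr x) ND.
have -> : N 0 = 0 by rewrite -(scale0r (0 : A)) NZ normr0 mul0r.
by lra.
Qed.

(* For [c = i] or [c = - i], the hypotheses say that [(1 - p) + c z] is unitary in
   the unitization. *)
Lemma seminorm_unitary p z w c :
  star p = p -> star z = z -> p ** z = z ** p ->
  z ** z = p + p - p ** p -> (c^*)%R = - c -> c * c = -1 ->
  N (w - p ** w + c *: (z ** w)) = N w.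
Proof.
move=> ps zs pz zz cs cc; have [_ _ Nstar] := HN.
(* By the C*-identity it suffices that (u w)^* (u w) = w^* w for the unitary u. *)
apply/eqP; rewrite -(@eqrXn2 _ 2)// ?seminorm_ge0// -!Nstar; apply/eqP.
congr N; rewrite starD starB starZ !starM ps zs cs.
pose P y : A := y - p ** y.
have PE y : (star w - star w ** p) ** y = star w ** P y.
  by rewrite bmulBl bmulBr -bmulA.
rewrite bmulDl PE bmulZl -(bmulA (star w)) -(bmulZr _ (star w)) -bmulDr.
congr (_ ** _).
rewrite -/(P w).
have PD y y' : P (y + y') = P y + P y'.
  by rewrite /P bmulDr opprD addrACA.
have PZ y : P (z ** y) = z ** P y by rewrite /P bmulBr !bmulA pz.
have PZc y : P (c *: y) = c *: P y by rewrite /P bmulZr scalerBr.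
rewrite PD PZc PZ (bmulDr z (P w)) (bmulZr c z) scalerDr scalerA mulNr cc.
rewrite opprK scale1r scaleNr addrA addrK bmulA zz /P bmulBr bmulBl bmulDl.
by rewrite -(bmulA p) -(addrA (p ** w)) addrACA subrK addNr addr0.
Qed.

(** The unitaries (1 - p) + i z and (1 - p) - i z both preserve [N]; half their sum is 1 - p and
    half their difference is i z. *)
Lemma seminorm_unitary_contract p z w :
  star p = p -> star z = z -> p ** z = z ** p ->
  z ** z = p + p - p ** p -> N (z ** w) <= N w /\ N (w - p ** w) <= N w.
Proof.
move=> ps zs pz zz; have [ND NZ _] := HN.
have U := seminorm_unitary w ps zs pz zz.
have ic := conjCi R[i]; have ii : 'i%R * 'i%R = -1 :> R[i].
  by rewrite -expr2 sqrCi.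
have ni : complex.Re `|'i%R : R[i]| = 1 by rewrite normCi.
have U1 := U _ ic ii.
have {U} : N (w - p ** w + (- 'i%R) *: (z ** w)) = N w.
  by apply: U; [rewrite rmorphN /= ic|rewrite mulrNN].
rewrite scaleNr => U2; have N2 x : N (x + x) = 2 * N x.
  rewrite -mulr2n -scaler_nat NZ normr_nat.
  by rewrite -(rmorph_nat (real_complex R)).
split.
- rewrite -(ler_pM2l (_ : 0 < 2 :> R))// -N2.
  have <- : N ('i%R *: (z ** w + z ** w)) = N (z ** w + z ** w).
    by rewrite NZ ni mul1r.
  have -> : 'i%R *: (z ** w + z ** w) =
      (w - p ** w + 'i%R *: (z ** w)) - (w - p ** w - 'i%R *: (z ** w)).
    rewrite scalerDr; set W := w - _; rewrite opprB.
    by rewrite (addrC W) addrACA subrr addr0.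
  rewrite (le_trans (ND _ _))// seminormN U1 U2; lra.
- rewrite -(ler_pM2l (_ : 0 < 2 :> R))// -N2.
  have -> : w - p ** w + (w - p ** w) =
      (w - p ** w + 'i%R *: (z ** w)) + (w - p ** w - 'i%R *: (z ** w)).
    by move: (w - p ** w) => W; rewrite addrACA subrr addr0.
  rewrite (le_trans (ND _ _))// U1 U2; lra.
Qed.

End Seminorm.

(** * Cartesian decomposition and functional calculus by iteration *)

Lemma scale2r_half x : (2^-1)%:C *: (x + x) = x.
Proof.
rewrite -mulr2n -(scaler_nat 2 x) scalerA -(rmorph_nat (real_complex R)).
by rewrite -rmorphM mulVf// scale1r.
Qed.

Lemma sa_decomp x :
  exists u v, [/\ star u = u, star v = v & x = u + 'i%R *: v].
Proof.
exists ((2^-1)%:C *: (x + star x)).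
exists ((2^-1)%:C *: ('i%R *: (star x - x))); split.
- by rewrite starZr starD starK addrC.
- by rewrite starZr starZ starB starK conjCi scaleNr -scalerN opprB.
rewrite scalerA mulrC -scalerA -scalerDr scalerA -expr2 sqrCi scaleN1r opprB.
by rewrite addrACA subrr addr0 scale2r_half.
Qed.

(* Here [s = 1 - sqrt (1 - v)] is the limit of the iteration [s <- (v + s^2)/2].
   The same iteration at the scalar [v = 1] is a majorant, which gives convergence
   in the boundary case [rnorm v = 1]. *)
Lemma one_sub_sqrt v : rnorm v <= 1 ->
  exists s, [/\ s + s = v + s ** s,
    forall x, x ** v = v ** x -> x ** s = s ** x,
    star v = v -> star s = s &
    forall x, rnorm (x ** s) <= rnorm (x ** v)].
Proof.
move=> v1.
pose F x : A := (2^-1)%:C *: (v + x ** x).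
pose f (t : R) : R := 2^-1 * (1 + t ^+ 2).
pose s n := iter n F 0; pose sigma n := iter n f 0.
have half0 : 0 <= 2^-1 :> R by rewrite invr_ge0.
have sigma01 n : 0 <= sigma n <= 1.
  elim: n => [|n /andP[IH0 IH1]]; first by rewrite lexx ler01.
  by rewrite /= -/(sigma n) /f; apply/andP; split; nra.
have s_le n : rnorm (s n) <= sigma n.
  elim: n => [|n IH]; first by rewrite rnorm0.
  have n0 := rnorm_ge0 (s n).
  rewrite /= -/(s n) -/(sigma n) rnormZr// ler_wpM2l//.
  rewrite (le_trans (rnormD _ _))// lerD// (le_trans (rnormM _ _))//.
  by rewrite expr2 ler_pM.
have ds_le n : rnorm (s n.+1 - s n) <= sigma n.+1 - sigma n.
  elim: n => [|n IH].
    rewrite /= /F /f bmul0l expr0n /= !addr0 !subr0 rnormZr//.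
    by rewrite ler_wpM2l.
  have n0 := rnorm_ge0 (s n.+1 - s n).
  (* The difference of squares a^2 - b^2 = a (a - b) + (a - b) b holds without commutativity. *)
  have -> : s n.+2 - s n.+1 = (2^-1)%:C *:
      (s n.+1 ** (s n.+1 - s n) + (s n.+1 - s n) ** s n).
    transitivity (F (s n.+1) - F (s n)) => //.
    rewrite /F -scalerBr opprD addrACA subrr.
    by rewrite add0r bmulBr bmulBl addrA subrK.
  have -> : sigma n.+2 - sigma n.+1 = 2^-1 *
      (sigma n.+1 * (sigma n.+1 - sigma n) +
      (sigma n.+1 - sigma n) * sigma n).
    by transitivity (f (sigma n.+1) - f (sigma n)) => //; rewrite /f; ring.
  rewrite rnormZr// ler_wpM2l// (le_trans (rnormD _ _))//.
  by rewrite lerD// (le_trans (rnormM _ _))// ler_pM ?rnorm_ge0 ?s_le.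
have sl : s @ \oo --> lim (s @ \oo).
  apply: (@cvg_majorant _ _ _ _ 1 ds_le) => n.
  by have /andP[] := sigma01 n.
have cx x : (fun _ : nat => x) @ \oo --> x by exact: cvg_cst.
move: (lim _) sl => l sl; exists l; split.
- have sSl : (fun n => s n.+1) @ \oo --> l by rewrite cvg_shiftS.
  have : (fun n => s n.+1) @ \oo --> (2^-1)%:C *: (v + l ** l).
    by apply: cvgZl_tmp; apply: cvgD; [exact: cvg_cst|exact: cvg_bmul].
  move=> /(norm_cvg_unique sSl) lE.
  by rewrite {1 2}lE -scalerDr scale2r_half.
- move=> x xv; have sx n : x ** s n = s n ** x.
    elim: n => [|n IH]; first by rewrite bmul0l bmul0r.
    rewrite [s n.+1]iterS -/(s n) /F bmulZl bmulZr bmulDl bmulDr xv.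
    by rewrite bmulA IH -bmulA IH bmulA.
  have := cvg_bmul sl (cx x).
  under eq_fun do rewrite -sx.
  exact: norm_cvg_unique (cvg_bmul (cx x) sl).
- move=> vs; have ss n : star (s n) = s n.
    elim: n => [|n IH]; first by rewrite star0.
    by rewrite [s n.+1]iterS -/(s n) /F starZr starD starM vs IH.
  have := cvg_star sl; under eq_fun do rewrite ss.
  by move=> /norm_cvg_unique; apply.
- move=> x; apply: (cvg_rnorm_le (cvg_bmul (cx x) sl)) => n /=.
  elim: n => [|n IH]; first by rewrite bmul0r rnorm0 rnorm_ge0.
  (* Here x s_(n+1) is the mean of x v and (x s_n) s_n, and s_n has norm at most 1. *)
  rewrite [s n.+1]iterS -/(s n) /F bmulZr rnormZr// bmulDr bmulA.
  rewrite -[leRHS](@mulKf _ 2)// ler_wpM2l// mulr2n mulrDl mul1r.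
  rewrite (le_trans (rnormD _ _))// lerD// (le_trans (rnormM _ _))//.
  rewrite -[leRHS]mulr1 ler_pM ?rnorm_ge0// (le_trans (s_le n))//.
  by have /andP[] := sigma01 n.
Qed.

(* For [s = 1 - sqrt (1 - k^2)], the selfadjoint contraction [k] is the imaginary
   part of the unitary [(1 - s) + i k]. *)
Lemma seminorm_selfadjoint_contract (N : A -> R) k w :
  cstar_seminorm N -> star k = k -> rnorm k <= 1 ->
  N (k ** w) <= N w /\ N (w - k ** k ** w) <= N w.
Proof.
move=> HN ks k1.
have kk1 : rnorm (k ** k) <= 1.
  by rewrite -{1}ks rnorm_cstar expr_le1// rnorm_ge0.
have [s [sE sk ss _]] := one_sub_sqrt kk1.
have {}sk : k ** s = s ** k by apply: sk; rewrite bmulA.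
have {}ss : star s = s by apply: ss; rewrite starM ks.
have kkE : k ** k = s + s - s ** s by rewrite sE addrK.
have U := seminorm_unitary_contract HN _ ss ks (esym sk) kkE.
split; first by have [] := U w.
(* Since 1 - k^2 = (1 - s)^2, the contraction 1 - s is applied twice. *)
have -> : w - k ** k ** w = (w - s ** w) - s ** (w - s ** w).
  rewrite kkE bmulBl bmulDl bmulBr bmulA.
  by rewrite -[in LHS]addrA opprD addrA.
by have [_ h] := U (w - s ** w); apply: le_trans h _; have [] := U w.
Qed.

(** For a selfadjoint contraction k, N(k)^2 = N(k k) <= N(k), so N(k) <= 1. Scaling handles every
    selfadjoint element, and the C*-identity reduces x to x^* x. *)
Lemma seminorm_le_rnorm (N : A -> R) x : cstar_seminorm N -> N x <= rnorm x.
Proof.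
move=> HN; have [_ NZ Nstar] := HN; have N0 := seminorm_ge0 HN.
have le1 k : star k = k -> rnorm k <= 1 -> N k <= 1.
  move=> ks k1; have [h _] := seminorm_selfadjoint_contract k HN ks k1.
  have := Nstar k; rewrite ks => Nk; rewrite {}Nk in h.
  by have := N0 k; nra.
have le_sa k (r : R) : star k = k -> 0 < r -> rnorm k <= r -> N k <= r.
  move=> ks r0 kr; have r1 : 0 <= r^-1 by rewrite invr_ge0 ltW.
  have : N ((r^-1)%:C *: k) <= 1.
    by apply: le1; rewrite ?starZr ?ks// rnormZr// ler_pdivrMl// mulr1.
  by rewrite NZ ger0_norm ?lecR// ler_pdivrMl// mulr1.
(* The slack [e] keeps the scaling factor positive even for k = 0. *)
have {}le_sa k : star k = k -> N k <= rnorm k.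
  move=> ks; apply/ler_addgt0Pr => e e0; apply: le_sa => //.
    by rewrite ltr_wpDl// rnorm_ge0.
  by rewrite lerDl ltW.
rewrite -(@ler_pXn2r _ 2)// ?nnegrE ?rnorm_ge0 ?N0// -Nstar -rnorm_cstar.
by apply: le_sa; rewrite starM starK.
Qed.

(* [1 - q] is the inverse of [1 + t^2 k^2] in the unitization. *)
Lemma quasi_inverse (t : R) k : star k = k -> rnorm k <= 1 ->
  exists q, [/\ forall x, x ** k = k ** x -> x ** q = q ** x,
    star q = q & q = (t ^+ 2)%:C *: (k ** k - k ** k ** q)].
Proof.
move=> ks k1.
have t1 : 0 < 1 + t ^+ 2 by rewrite ltr_pwDl// sqr_ge0.
(* Adding t^2 q to both sides of q = t^2 (k^2 - k^2 q) makes q a fixed point of [F]. As 1 - k^2 is a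
   contraction, [F] has ratio rho < 1; its scalar majorant [f] has fixed point t^2. *)
pose rho := t ^+ 2 / (1 + t ^+ 2).
have rho0 : 0 <= rho by rewrite divr_ge0 ?sqr_ge0// ltW.
have rho1 : rho * (1 + t ^+ 2) = t ^+ 2 by rewrite divfK// gt_eqF.
pose F x : A := rho%:C *: (k ** k + (x - k ** k ** x)).
pose f (u : R) : R := rho * (1 + u).
pose s n := iter n F 0; pose sigma n := iter n f 0.
have contract w : rnorm (w - k ** k ** w) <= rnorm w.
  by have [] := seminorm_selfadjoint_contract w rnorm_cstar_seminorm ks k1.
have sigma_le n : sigma n <= t ^+ 2.
  elim: n => [|n IH]; first exact: sqr_ge0.
  by rewrite -[sigma _]/(f (sigma n)) /f -[leRHS]rho1 ler_wpM2l// lerD2l.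
have ds_le n : rnorm (s n.+1 - s n) <= sigma n.+1 - sigma n.
  elim: n => [|n IH].
    rewrite /= /F /f bmul0r subrr !addr0 !subr0 rnormZr// ler_wpM2l//.
    by rewrite -{1}ks rnorm_cstar expr_le1// rnorm_ge0.
  have -> : s n.+2 - s n.+1 =
      rho%:C *: ((s n.+1 - s n) - k ** k ** (s n.+1 - s n)).
    transitivity (F (s n.+1) - F (s n)) => //.
    rewrite /F -scalerBr opprD addrACA subrr add0r bmulBr.
    by rewrite !opprD addrACA.
  have -> : sigma n.+2 - sigma n.+1 = rho * (sigma n.+1 - sigma n).
    by transitivity (f (sigma n.+1) - f (sigma n)) => //; rewrite /f; ring.
  by rewrite rnormZr// ler_wpM2l// (le_trans (contract _)).
have sx x n : x ** k = k ** x -> x ** s n = s n ** x.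
  move=> xk; elim: n => [|n IH]; first by rewrite bmul0l bmul0r.
  have xkk : x ** (k ** k) = k ** k ** x by rewrite bmulA xk -bmulA xk bmulA.
  rewrite [s n.+1]iterS -/(s n) /F bmulZl bmulZr bmulDl bmulDr bmulBl bmulBr.
  by rewrite (bmulA x (k ** k)) xkk -(bmulA (k ** k) x) IH (bmulA _ (s n)).
have sl := cvg_majorant ds_le sigma_le.
have cx x : (fun _ : nat => x) @ \oo --> x by exact: cvg_cst.
move: (lim _) sl => l sl; exists l; split.
- move=> x xk; have := cvg_bmul sl (cx x).
  under eq_fun do rewrite -sx//.
  exact: norm_cvg_unique (cvg_bmul (cx x) sl).
- have ss n : star (s n) = s n.
    elim: n => [|n IH]; first by rewrite star0.
    rewrite [s n.+1]iterS -/(s n) /F starZr starD starB !starM ks IH.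
    by rewrite (sx (k ** k))// bmulA.
  have := cvg_star sl; under eq_fun do rewrite ss.
  by move=> /norm_cvg_unique; apply.
- have sSl : (fun n => s n.+1) @ \oo --> l by rewrite cvg_shiftS.
  have : (fun n => s n.+1) @ \oo --> F l.
    apply: cvgZl_tmp; apply: cvgD; first exact: cx.
    by apply: cvgB => //; exact: cvg_bmul.
  move=> /(norm_cvg_unique sSl) lE.
  have {lE} : (1 + t ^+ 2)%:C *: l =
      (t ^+ 2)%:C *: (k ** k + (l - k ** k ** l)).
    by rewrite {1}lE /F scalerA -rmorphM mulrC rho1.
  rewrite rmorphD /= scalerDl scale1r addrCA scalerDr [l + _]addrC.
  exact: addrI.
Qed.

(* With [y = (1 + t^2 k^2)^-1 = 1 - q], the elements [1 - p = 2y - 1] and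
   [z = 2 t k y] are the cosine and sine of a unitary, and
   [s = 1 - |1 - p|]. Then [e = (p + s)/2 = min(p, 1)] is a unit for
   [(p - s)/2 = (p - 1)_+], which is far from 1 only where [k] is of order [1/t]. *)
Lemma local_unit_contract (t : R) k : 0 < t -> star k = k -> rnorm k <= 1 ->
  exists e x, e ** x = x /\ rnorm (k - x) <= 2 / t.
Proof.
move=> t0 ks k1.
have [q [qc qs qE]] := quasi_inverse t ks k1.
have qk : q ** k = k ** q by rewrite qc.
have [h hE] : exists h, h = k - k ** q by exists (k - k ** q).
pose p := q + q; pose z := t%:C *: (h + h).
have hq : h ** q = q ** h by rewrite hE bmulBl bmulBr -qk -bmulA -qk.
have hs : star h = h by rewrite hE starB starM ks qs qk.
have ps : star p = p by rewrite starD qs.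
have zs : star z = z by rewrite starZr starD hs.
have pz : p ** z = z ** p.
  by rewrite /p /z bmulZl bmulZr !(bmulDl, bmulDr) hq.
(* The equation for [q] reads t^2 k h = q, and h = k (1 - q). *)
have hh : (t ^+ 2)%:C *: (h ** h) = q - q ** q.
  rewrite {1}hE bmulBl scalerBr -(bmulA k q) -hq bmulA -(bmulZl _ (k ** h)).
  have -> : k ** h = k ** k - k ** k ** q by rewrite hE bmulBr bmulA.
  by rewrite -qE.
have zz : z ** z = p + p - p ** p.
  rewrite /z /p bmulZl bmulZr scalerA -rmorphM -expr2.
  rewrite !(bmulDl, bmulDr) !scalerDr hh !opprD.
  by rewrite (addrACA q) [LHS]addrACA.
have U := seminorm_unitary_contract rnorm_cstar_seminorm _ ps zs pz zz.
(* Applied to [z] itself, the contraction gives |z|^2 = |z z| <= |z|. *)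
have z1 : rnorm z <= 1.
  have [zz1 _] := U z; have := rnorm_cstar z; rewrite zs => E.
  by have := rnorm_ge0 z; rewrite E in zz1; nra.
have v1 : rnorm (z ** z) <= 1.
  by rewrite -{1}zs rnorm_cstar expr_le1// rnorm_ge0.
have [s [sE sc _ sn]] := one_sub_sqrt v1.
have pv : p ** (z ** z) = z ** z ** p by rewrite bmulA pz -bmulA pz bmulA.
have psE := sc p pv.
have kz : k ** z = z ** k.
  by rewrite bmulZl bmulZr bmulDl bmulDr hE bmulBl bmulBr -!bmulA qk.
have ks' : k ** s = s ** k by apply: sc; rewrite bmulA kz -bmulA kz bmulA.
exists ((2^-1)%:C *: (p + s)), ((2^-1)%:C *: (p - s) ** k); split.
  (* Both p and s solve y^2 = 2 y - z^2 and they commute, so (p + s)(p - s) = p^2 - s^2 = 2 (p -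
     s). *)
  rewrite bmulA; congr (_ ** _); rewrite bmulZl bmulZr; congr (_ *: _).
  rewrite bmulDl !bmulBr psE addrA subrK.
  have -> : p ** p = p + p - z ** z by rewrite zz subKr.
  have -> : s ** s = s + s - z ** z by rewrite sE addrAC subrr add0r.
  rewrite opprB addrA subrK opprD addrACA.
  exact: scale2r_half.
have -> : k - (2^-1)%:C *: (p - s) ** k = h + (2^-1)%:C *: (k ** s).
  rewrite bmulZl bmulBl scalerBr -ks' opprB addrCA addrC; congr (_ + _).
  by rewrite bmulDl scale2r_half qk.
(* This is |z| <= 1 for z = 2 t h. *)
have hn : rnorm h <= 2^-1 / t.
  rewrite ler_pdivlMr// mulrC -[h]scale2r_half rnormZr// mulrCA.
  rewrite -(rnormZr _ (ltW t0)) -/z.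
  by rewrite -[leRHS]mulr1 ler_wpM2l.
have ksn : rnorm (k ** s) <= 2 / t.
  apply: le_trans (sn k) _.
  (* Because z^2 = 2 (1 - q) p and k (1 - q) = h, one factor [k] gains 1/t; then |z p| <= |z| + |z -
     p z| <= 2. *)
  have -> : k ** (z ** z) = (t^-1)%:C *: (z ** p).
    rewrite [z ** p]bmulZl scalerA -rmorphM mulVf ?gt_eqF// scale1r zz.
    have -> : p + p - p ** p = (p - q ** p) + (p - q ** p).
      by rewrite -[p ** p]/((q + q) ** p) bmulDl opprD addrACA.
    have kp : k ** (p - q ** p) = h ** p by rewrite hE bmulBl bmulBr bmulA.
    by rewrite bmulDr bmulDl kp.
  have ti0 : 0 <= t^-1 by rewrite invr_ge0 ltW.
  rewrite rnormZr// mulrC ler_wpM2r//.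
  have [_ zpz] := U z; rewrite -pz -(subKr z (p ** z)).
  rewrite (le_trans (rnormD _ _))// rnormN.
  by move: z1 zpz; lra.
rewrite (le_trans (rnormD _ _))// rnormZr//.
have : 0 < t^-1 by rewrite invr_gt0.
nra.
Qed.

Lemma local_unit (r : R) k : 0 < r -> star k = k ->
  exists e x, e ** x = x /\ rnorm (k - x) <= r.
Proof.
move=> r0 ks; pose m := rnorm k + 1.
have m0 : 0 < m by rewrite ltr_wpDl// rnorm_ge0.
have mi0 : 0 <= m^-1 by rewrite invr_ge0 ltW.
have kE : k = m%:C *: ((m^-1)%:C *: k).
  by rewrite scalerA -rmorphM mulfV ?gt_eqF// scale1r.
(* The parameter t = 2 m / r makes the rescaled error m (2 / t) equal to [r]. *)
have [|||e [x [ex kx]]] := @local_unit_contract (2 * m / r) ((m^-1)%:C *: k).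
- by rewrite divr_gt0// mulr_gt0.
- by rewrite starZr ks.
- by rewrite rnormZr// ler_pdivrMl// mulr1 lerDl.
exists e, (m%:C *: x); split; first by rewrite bmulZr ex.
rewrite {1}kE -scalerBr (rnormZr _ (ltW m0)).
rewrite -ler_pdivlMl//.
have <- : 2 / (2 * m / r) = m^-1 * r by field; rewrite !gt_eqF.
exact: kx.
Qed.

End CStarAlgebraTheory.

(** * The canonical matrix norms, in particular on 1 x 1 matrices *)

Section MatrixNorm.
Context {R : realType} {A : cstarAlgType R}.

Lemma mxnorm_ge0 p (x : 'M[A]_p) : 0 <= mxnorm x.
Proof.
(* The default value of [xget] is 0, so only an actual C*-norm remains. *)
rewrite /mxnorm; case: xgetP => [N _ HN|_]; last exact: lexx.
have scale0 : mxscale 0 x = 0 by apply/matrixP => i k; rewrite !mxE scale0r.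
have scaleN1 : mxscale (-1) x = - x.
  by apply/matrixP => i k; rewrite !mxE scaleN1r.
have N0 : N 0 = 0 by rewrite -scale0 (mxnormZ HN) normr0 mul0r.
have : N (x - x) <= N x + N (- x) by exact: mxnormD HN _ _.
rewrite subrr N0 -scaleN1 (mxnormZ HN) normrN normr1 mul1r.
lra.
Qed.

(** Provides the existence that excludes the default value of [mxnorm] in size 1. *)
Lemma rnorm_cstar_mxnorm1 : is_cstar_mxnorm (fun x : 'M[A]_1 => rnorm (x 0 0)).
Proof.
split.
- move=> x /rnorm0_eq0 x0; apply/matrixP => i k.
  by rewrite !ord1 x0 mxE.
- by move=> x y; rewrite mxE rnormD.
- by move=> c x; rewrite mxE rnormZ.
- by move=> x y; rewrite mxE big_ord1 rnormM.
- by move=> x; rewrite mxE big_ord1 mxE rnorm_cstar.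
Qed.

Lemma mxnorm1_le (a : A) : mxnorm (const_mx a : 'M[A]_1) <= rnorm a.
Proof.
rewrite /mxnorm; case: xgetP => [N _ HN|/(_ _ rnorm_cstar_mxnorm1)//].
apply: (seminorm_le_rnorm (N := fun a => N (const_mx a))); split.
- move=> x y; apply: le_trans (mxnormD HN _ _).
  by rewrite le_eqVlt; apply/orP; left; apply/eqP; congr N;
    apply/matrixP => i k; rewrite !mxE.
- move=> c x; rewrite -(mxnormZ HN); congr N; apply/matrixP => i k.
  by rewrite !mxE.
- move=> x; rewrite -(mxnorm_cstar HN); congr N; apply/matrixP => i k.
  by rewrite !mxE big_ord1 !mxE.
Qed.

End MatrixNorm.

(** * Elementary tensors in the projective norm *)

Section ProjectiveTensorProduct.
Context {R : realType} {A B : cstarAlgType R}.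

Lemma opproj_norm_tens (a : A) (b : B) :
  opproj_norm (tens a b) <= rnorm a * rnorm b.
Proof.
apply: (@le_trans _ _ (hsnorm (const_mx 1 : 'rV[R[i]]_(1 * 1)) *
   mxnorm (const_mx a : 'M[A]_1) * mxnorm (const_mx b : 'M[B]_1) *
   hsnorm (const_mx 1 : 'cV[R[i]]_(1 * 1)))); last first.
  rewrite /hsnorm !big_ord1 !mxE normr1 expr1n sqrtr1 mul1r mulr1.
  by rewrite ler_pM ?mxnorm_ge0 ?mxnorm1_le.
(* The infimum is tested at p = q = 1 with alpha = beta = 1; 0 is a lower bound of the set. *)
apply: ge_inf.
  exists 0 => _ [p [q [alpha [x [y [beta [_ ->]]]]]]].
  by rewrite !mulr_ge0 ?mxnorm_ge0// sqrtr_ge0.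
exists 1%N, 1%N, (const_mx 1), (const_mx a), (const_mx b), (const_mx 1).
by split=> //; rewrite /mxsandwich !big_ord1 !mxE mulr1 scale1r.
Qed.

End ProjectiveTensorProduct.

Theorem corollary2p7 (R : realType) (A B : cstarAlgType R)
    (D : banachAlgType R) (j : {linear atensor A B -> D})
    (hD : is_opproj_tensor j) :
  weakly_wiener D.
Proof.
move=> I Iideal Iclosed IT; apply: contrapT => noP; apply: IT.
have [[[I0 I2] I3] I4] := Iideal.
have ID x y : I x -> I y -> I (x + y).
  by move=> Ix Iy; rewrite -[x]scale1r; exact: I2.
have IZ c x : I x -> I (c *: x).
  by move=> Ix; rewrite -[_ *: _]addr0; exact: I2.
have jle a b : rnorm (j (tens a b)) <= rnorm a * rnorm b.
  by rewrite (opproj_isometry hD) opproj_norm_tens.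
have Isa a b : star a = a -> star b = b -> I (j (tens a b)).
  move=> sa sb; apply: (closed_rnorm Iclosed) => r r0.
  have [||||d d0 dP] :=
    @bounded_biadditive_continuous R A B D (fun a b => j (tens a b)) a b r.
  - by move=> *; rewrite linearBl linearB.
  - by move=> *; rewrite linearBr linearB.
  - exact: jle.
  - exact: r0.
  have [e [x [ex ax]]] := local_unit d0 sa.
  have [e' [x' [ex' bx']]] := local_unit d0 sb.
  exists (j (tens x x')); split; last exact: dP.
  (* The tensor of the two local units is a left unit for that of [x] and [x']. *)
  apply: (@local_unit_in_ideal _ _ _ (j (tens e e'))) => //.
  by rewrite (opproj_mul hD) ex ex'.
(* Each factor is split into its selfadjoint real and imaginary parts. *)
have Itens a b : I (j (tens a b)).
  have Isa' b' : star b' = b' -> I (j (tens a b')).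
    move=> sb; have [u [v [su sv ->]]] := sa_decomp a.
    rewrite linearDl linearZl_LR linearD linearZ.
    by apply: ID; [exact: Isa|apply: IZ; exact: Isa].
  have [u [v [su sv ->]]] := sa_decomp b.
  rewrite linearDr linearZr linearD linearZ.
  by apply: ID; [exact: Isa'|apply: IZ; exact: Isa'].
have Irange u : I (j u).
  have [s ->] := atensorE u; rewrite linear_sum.
  by apply: big_ind => // ab _.
(* The closed ideal [I] contains the dense range of [j]. *)
rewrite -subTset => x _; apply: (closed_rnorm Iclosed) => r r0.
have rC : 0 < r%:C by rewrite ltcR.
have [||y [xy [u _ yE]]] := @opproj_dense _ _ _ _ _ hD (ball x r%:C).
- by exists x; exact: ballxx.
- exact: ball_open.
exists y; split; first by rewrite -yE.
by move: xy; rewrite -ball_normE /ball_ /= rnormE ltcR => /ltW.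
Qed.
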